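(* Let $\Gamma$ be a finitely generated nilpotent group of class $t$ and let $\alpha:\Gamma\to\Gamma$ be an endomorphism. Let $\Gamma_1=\Gamma$ and $\Gamma_{j+1}=[\Gamma,\Gamma_j]$ be the lower central series. Then: (1) $GR(\alpha)=\max_{1\le k\le t}\{GR(\alpha\text{ on }\Gamma_k/\Gamma_{k+1})^{1/k}\}$; (2) $GR(\alpha)=\max\{GR(\alpha\text{ on }\Gamma/\Gamma_t),\ GR(\alpha\text{ on }\Gamma_t)^{1/t}\}$, where $\Gamma/\Gamma_t$ is a finitely generated nilpotent group of class $t-1$ and $\Gamma_t$ is central in $\Gamma$.
   Context: For a group $G$ with finite generating set $T$ and $g\in G$, $|g|_T$ denotes the length of the shortest word in the letters $T\cup T^{-1}$ representing $g$. The growth rate of an endomorphism $\beta:G\to G$ is $GR(\beta)=\sup_{g\in G}\ \limsup_{m\to\infty}\sqrt[m]{|\beta^m(g)|_T}$. An endomorphism $\alpha$ of $\Gamma$ maps each $\Gamma_k$ into itself; $GR(\alpha\text{ on }\Gamma_t)$ is the growth rate of the restriction of $\alpha$ to $\Gamma_t$, and $GR(\alpha\text{ on }\Gamma_k/\Gamma_{k+1})$, $GR(\alpha\text{ on }\Gamma/\Gamma_t)$ are the growth rates of the endomorphisms of these quotients induced by $\alpha$. *)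

(* Defs.v *)
From HB Require Import structures.
From mathcomp Require Import all_boot all_order all_algebra generic_quotient.
From mathcomp Require Import all_classical all_reals all_analysis.

Set Implicit Arguments.
Unset Strict Implicit.
Unset Printing Implicit Defensive.

Import Order.TTheory GRing.Theory Num.Theory.

Local Open Scope classical_set_scope.
Local Open Scope quotient_scope.
Local Open Scope group_scope.

(** * Subgroups *)

Definition is_subgroup (G : groupType) (H : set G) : Prop :=
  H 1 /\ forall x y, H x -> H y -> H (x / y).

Record subgroup (G : groupType) := Subgroup {
  subgroup_set : set G;
  subgroupP : is_subgroup subgroup_set }.

Definition is_normal (G : groupType) (N : set G) : Prop :=
  is_subgroup N /\ forall x y, N x -> N (x ^ y).

Record normal_subgroup (G : groupType) := NormalSubgroup {
  normal_set : set G;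
  normalP : is_normal normal_set }.

Definition gen (G : groupType) (A : set G) : set G :=
  smallest (@is_subgroup G) A.

Record subg (G : groupType) (H : subgroup G) : Type := Subg {
  subg_val : G;
  subg_valP : subg_val \in subgroup_set H }.

HB.instance Definition _ (G : groupType) (H : subgroup G) :=
  [isSub for @subg_val G H].
HB.instance Definition _ (G : groupType) (H : subgroup G) :=
  [Choice of subg H by <:].

Lemma subgroup_closed (G : groupType) (H : subgroup G) :
  group_closed [pred x : G | x \in subgroup_set H].
Proof.
have [H1 HD] := subgroupP H; split=> [|x y]; rewrite !inE; first exact: H1.
exact: HD.
Qed.

HB.instance Definition _ (G : groupType) (H : subgroup G) :=
  SubChoice_isSubGroup.Build G [pred x : G | x \in subgroup_set H] (subg H)
    (subgroup_closed H).

Lemma restr_subproof (G : groupType) (H : subgroup G) (f : G -> G)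
  (fH : forall x, subgroup_set H x -> subgroup_set H (f x)) (x : subg H) :
  f (val x) \in subgroup_set H.
Proof. by apply/mem_set/fH/set_mem/(valP x). Qed.

Definition restr (G : groupType) (H : subgroup G) (f : G -> G)
    (fH : forall x, subgroup_set H x -> subgroup_set H (f x)) : subg H -> subg H :=
  fun x => Sub (f (val x)) (restr_subproof fH x).

Lemma restrM (G : groupType) (H : subgroup G) (f : {multiplicative G -> G})
  (fH : forall x, subgroup_set H x -> subgroup_set H (f x)) :
  {morph restr fH : x y / x * y}.
Proof. by move=> x y; apply: val_inj; rewrite /= gmulfM. Qed.

(** * Quotients by normal subgroups *)

Definition coset_rel (G : groupType) (N : normal_subgroup G) : rel G :=
  fun x y => `[< normal_set N (x^-1 * y) >].

Lemma is_subgroupV (G : groupType) (H : set G) x :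
  is_subgroup H -> H x -> H x^-1.
Proof. by move=> [H1 HD] Hx; rewrite -[x^-1]mul1g; apply: HD. Qed.

Lemma is_subgroupM (G : groupType) (H : set G) x y :
  is_subgroup H -> H x -> H y -> H (x * y).
Proof.
move=> sH Hx Hy; rewrite -[y]invgK; apply: sH.2 => //.
exact: is_subgroupV.
Qed.

Lemma coset_rel_refl (G : groupType) (N : normal_subgroup G) :
  reflexive (coset_rel N).
Proof. by move=> x; apply/asboolP; rewrite mulVg; have [[]] := normalP N. Qed.

Lemma coset_rel_sym (G : groupType) (N : normal_subgroup G) :
  symmetric (coset_rel N).
Proof.
have [sN _] := normalP N.
by move=> x y; apply/asboolP/asboolP => /(is_subgroupV sN);
  rewrite invgM invgK.
Qed.

Lemma coset_rel_trans (G : groupType) (N : normal_subgroup G) :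
  transitive (coset_rel N).
Proof.
have [sN _] := normalP N.
move=> y x z /asboolP Nxy /asboolP Nyz; apply/asboolP.
by have := is_subgroupM sN Nxy Nyz; rewrite mulgA mulgK.
Qed.

Canonical coset_equiv (G : groupType) (N : normal_subgroup G) :=
  EquivRel (coset_rel N) (coset_rel_refl N) (@coset_rel_sym G N)
    (@coset_rel_trans G N).

Definition quot (G : groupType) (N : normal_subgroup G) : Type :=
  {eq_quot (coset_rel N)}.

HB.instance Definition _ (G : groupType) (N : normal_subgroup G) :=
  Choice.on (quot N).
HB.instance Definition _ (G : groupType) (N : normal_subgroup G) :=
  EqQuotient.on (quot N).

Definition quot_mul (G : groupType) (N : normal_subgroup G) (x y : quot N) :
  quot N := \pi_(quot N) (repr x * repr y).
Definition quot_inv (G : groupType) (N : normal_subgroup G) (x : quot N) :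
  quot N := \pi_(quot N) (repr x)^-1.

Lemma quot_eq (G : groupType) (N : normal_subgroup G) (x y : G) :
  \pi_(quot N) x = \pi_(quot N) y <-> normal_set N (x^-1 * y).
Proof.
split; first by move/eqquotP => /asboolP.
by move=> Nxy; apply/eqquotP/asboolP.
Qed.

Lemma repr_pi (G : groupType) (N : normal_subgroup G) (x : G) :
  normal_set N ((repr (\pi_(quot N) x))^-1 * x).
Proof. by apply/quot_eq; rewrite reprK. Qed.

Lemma pi_quot_mul (G : groupType) (N : normal_subgroup G) (x y : G) :
  quot_mul (\pi_(quot N) x) (\pi_(quot N) y) = \pi_(quot N) (x * y).
Proof.
have [sN nN] := normalP N.
apply/quot_eq; have /(nN _ y) Nx := repr_pi N x; have Ny := repr_pi N y.
move: Nx Ny; set x' := repr _; set y' := repr _ => Nx Ny.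
have := is_subgroupM sN Ny Nx.
by rewrite /conjg invgM !mulgA mulgK.
Qed.

Lemma pi_quot_inv (G : groupType) (N : normal_subgroup G) (x : G) :
  quot_inv (\pi_(quot N) x) = \pi_(quot N) x^-1.
Proof.
have [sN nN] := normalP N.
apply/quot_eq; have /(nN _ x^-1) := repr_pi N x.
set x' := repr _ => /(is_subgroupV sN).
by rewrite /conjg mulgK invgM !invgK.
Qed.

Lemma quot_mulA (G : groupType) (N : normal_subgroup G) :
  associative (@quot_mul G N).
Proof.
move=> x y z; rewrite -[x]reprK -[y]reprK -[z]reprK.
by rewrite (pi_quot_mul N (repr y)) (pi_quot_mul N (repr x) (repr y))
  (pi_quot_mul N (repr x)) (pi_quot_mul N (repr x * repr y)) mulgA.
Qed.

Lemma quot_mul1 (G : groupType) (N : normal_subgroup G) :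
  left_id (\pi_(quot N) 1) (@quot_mul G N).
Proof. by move=> x; rewrite -[x]reprK pi_quot_mul mul1g. Qed.

Lemma quot_mul1r (G : groupType) (N : normal_subgroup G) :
  right_id (\pi_(quot N) 1) (@quot_mul G N).
Proof. by move=> x; rewrite -[x]reprK pi_quot_mul mulg1. Qed.

Lemma quot_mulV (G : groupType) (N : normal_subgroup G) :
  left_inverse (\pi_(quot N) 1) (@quot_inv G N) (@quot_mul G N).
Proof. by move=> x; rewrite -[x]reprK pi_quot_inv pi_quot_mul mulVg. Qed.

Lemma quot_mulVr (G : groupType) (N : normal_subgroup G) :
  right_inverse (\pi_(quot N) 1) (@quot_inv G N) (@quot_mul G N).
Proof. by move=> x; rewrite -[x]reprK pi_quot_inv pi_quot_mul mulgV. Qed.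

HB.instance Definition _ (G : groupType) (N : normal_subgroup G) :=
  isGroup.Build (quot N) (@quot_mulA G N) (@quot_mul1 G N) (@quot_mul1r G N)
    (@quot_mulV G N) (@quot_mulVr G N).

Lemma piM (G : groupType) (N : normal_subgroup G) :
  {morph \pi_(quot N) : x y / x * y}.
Proof. by move=> x y; rewrite -pi_quot_mul. Qed.

(* Independent of the representatives when [f] is a homomorphism mapping [N]
   into itself: see [induced_pi] below. *)
Definition induced (G : groupType) (N : normal_subgroup G) (f : G -> G) :
  quot N -> quot N := fun x => \pi_(quot N) (f (repr x)).

Lemma gmulfV1 (G : groupType) (f : {multiplicative G -> G}) :
  f 1 = 1 /\ forall x, f x^-1 = (f x)^-1.
Proof.
have f1 : f 1 = 1.
  by apply: (mulgI (f 1)); rewrite -gmulfM !mulg1.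
by split=> // x; apply: (mulgI (f x)); rewrite -gmulfM !mulgV.
Qed.

Lemma induced_pi (G : groupType) (N : normal_subgroup G)
    (f : {multiplicative G -> G}) (fN : forall x, normal_set N x -> normal_set N (f x)) (x : G) :
  induced f (\pi_(quot N) x) = \pi_(quot N) (f x).
Proof.
by apply/quot_eq; rewrite -(gmulfV1 f).2 -gmulfM; apply/fN/repr_pi.
Qed.

Lemma inducedM (G : groupType) (N : normal_subgroup G)
    (f : {multiplicative G -> G}) (fN : forall x, normal_set N x -> normal_set N (f x)) :
  {morph (@induced G N f) : x y / x * y}.
Proof.
move=> x y; rewrite -[x]reprK -[y]reprK -piM !induced_pi //.
by rewrite gmulfM piM.
Qed.

(** * The lower central series *)

Definition commutator_subgroup (G : groupType) (A B : set G) : set G :=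
  gen [set [~ x, y] | x in A & y in B].

(* Indexed from 1 as usual; the value [setT] at index 0 is a dummy. *)
Definition lcs (G : groupType) (k : nat) : set G :=
  iter k.-1 (commutator_subgroup setT) setT.
Arguments lcs : clear implicits.

(* [t] is the least number with Gamma_(t+1) = 1; the trivial group, and only
   it, has class 0. *)
Definition nilpotency_class (G : groupType) (t : nat) : Prop :=
  lcs G t.+1 = [set 1] /\ forall c, (c < t)%N -> lcs G c.+1 <> [set 1].

Lemma gen_subgroup (G : groupType) (A : set G) : is_subgroup (gen A).
Proof.
split=> [H [] [] //|x y Ax Ay H HA].
by apply: (HA.1.2); [exact: Ax | exact: Ay].
Qed.

Lemma gen_image (G : groupType) (f : {multiplicative G -> G}) (A : set G) :
  (forall x, A x -> gen A (f x)) -> forall x, gen A x -> gen A (f x).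
Proof.
move=> fA x Ax; apply: (Ax (f @^-1` gen A)); split; last exact: fA.
have [f1 fV] := gmulfV1 f; have [g1 gD] := gen_subgroup A.
by split=> [|y z] /=; [rewrite f1 | rewrite gmulfM fV; apply: gD].
Qed.

Lemma gen_sub (G : groupType) (A : set G) : A `<=` gen A.
Proof. by move=> x Ax H [_]; apply. Qed.

Lemma lcs_subgroup (G : groupType) k : is_subgroup (lcs G k).
Proof. by case: k => [|[|k]] //=; apply: gen_subgroup. Qed.

Lemma lcs_stable (G : groupType) (f : {multiplicative G -> G}) k x :
  lcs G k x -> lcs G k (f x).
Proof.
case: k => [|k] //; rewrite /lcs /=; elim: k x => [|k IHk] //= x.
apply: gen_image => _ [y _ [z Lz <-]]; apply: gen_sub.
exists (f y) => //; exists (f z); first exact: IHk.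
by rewrite /commg /conjg !gmulfM !(gmulfV1 f).2.
Qed.

Definition conj_by (G : groupType) (y x : G) : G := x ^ y.

Lemma conj_byM (G : groupType) (y : G) : {morph conj_by y : a b / a * b}.
Proof. by move=> a b; rewrite /conj_by conjMg. Qed.

HB.instance Definition _ (G : groupType) (y : G) :=
  isMultiplicative.Build G G (conj_by y) (conj_byM y).

Lemma lcs_is_normal (G : groupType) k : is_normal (lcs G k).
Proof.
split; first exact: lcs_subgroup.
by move=> x y; apply: (lcs_stable (conj_by y)).
Qed.

Definition lcs_sub (G : groupType) (k : nat) : subgroup G :=
  Subgroup (lcs_subgroup G k).
Definition lcs_normal (G : groupType) (k : nat) : normal_subgroup G :=
  NormalSubgroup (lcs_is_normal G k).

Lemma relative_is_normal (G : groupType) (H : subgroup G)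
    (N : normal_subgroup G) :
  is_normal [set x : subg H | normal_set N (val x)].
Proof.
have [[N1 ND] NJ] := normalP N.
split; [split=> [|x y] /= | move=> x y /=].
- by [].
- exact: ND.
- exact: NJ.
Qed.

(* The subgroup [N :&: H] of [H]. *)
Definition relative (G : groupType) (H : subgroup G) (N : normal_subgroup G) :
  normal_subgroup (subg H) := NormalSubgroup (relative_is_normal H N).

Definition lcs_group (G : groupType) (k : nat) : groupType :=
  subg (lcs_sub G k).
Definition lcs_quot (G : groupType) (k : nat) : groupType :=
  quot (lcs_normal G k).
Definition lcs_factor (G : groupType) (k : nat) : groupType :=
  quot (relative (lcs_sub G k) (lcs_normal G k.+1)).

Definition on_lcs_group (G : groupType) (f : {multiplicative G -> G})
    (k : nat) : lcs_group G k -> lcs_group G k :=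
  @restr G (lcs_sub G k) f (lcs_stable f (k := k)).
Arguments on_lcs_group {G} f k _ : simpl never.
Definition on_lcs_quot (G : groupType) (f : {multiplicative G -> G})
    (k : nat) : lcs_quot G k -> lcs_quot G k :=
  @induced G (lcs_normal G k) f.
Arguments on_lcs_quot {G} f k _ : simpl never.
Definition on_lcs_factor (G : groupType) (f : {multiplicative G -> G})
    (k : nat) : lcs_factor G k -> lcs_factor G k :=
  @induced _ (relative (lcs_sub G k) (lcs_normal G k.+1)) (on_lcs_group f k).
Arguments on_lcs_factor {G} f k _ : simpl never.

HB.instance Definition _ (G : groupType) (f : {multiplicative G -> G}) k :=
  isMultiplicative.Build _ _ (on_lcs_group f k)
    (@restrM G (lcs_sub G k) f (lcs_stable f (k := k))).

Lemma on_lcs_quot_pi (G : groupType) (f : {multiplicative G -> G}) k (x : G) :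
  let Q := quot (lcs_normal G k) in
  on_lcs_quot f k (\pi_Q x) = \pi_Q (f x).
Proof. by apply: induced_pi => y; apply: lcs_stable. Qed.

Lemma on_lcs_factor_pi (G : groupType) (f : {multiplicative G -> G}) k
    (x : lcs_group G k) :
  let Q := quot (relative (lcs_sub G k) (lcs_normal G k.+1)) in
  on_lcs_factor f k (\pi_Q x) = \pi_Q (on_lcs_group f k x).
Proof.
apply: (@induced_pi _ (relative (lcs_sub G k) (lcs_normal G k.+1))
          (on_lcs_group f k)) => y.
exact: (@lcs_stable G f k.+1).
Qed.

(** * Word length and growth rate *)

Definition generates (G : groupType) (T : seq G) : Prop := gen [set` T] = setT.

Definition finitely_generated (G : groupType) : Prop :=
  exists T : seq G, generates T.

Definition spelled (G : groupType) (T : seq G) (g : G) (n : nat) : Prop :=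
  exists w : seq G, [/\ all (fun x => (x \in T) || (x^-1 \in T)) w,
                        \prod_(x <- w) x = g & size w = n].

(* The default value 0 only occurs outside the subgroup generated by [T]. *)
Definition word_length (G : groupType) (T : seq G) (g : G) : nat :=
  xget 0%N [set n | spelled T g n /\ forall m, spelled T g m -> (n <= m)%N].

Definition GR (R : realType) (G : groupType) (T : seq G) (beta : G -> G) :
    \bar R :=
  ereal_sup [set limn_esup (fun m : nat =>
    (((word_length T (iter m beta g))%:R : R) `^ (m%:R^-1))%R%:E) | g in setT].

(* Main.v *)
Require Import Defs.
From HB Require Import structures.
From mathcomp Require Import all_boot all_order all_algebra generic_quotient.
From mathcomp Require Import all_classical all_reals all_analysis.
From mathcomp Require Import ring lra.

Set Implicit Arguments.
Unset Strict Implicit.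
Unset Printing Implicit Defensive.

Import Order.TTheory GRing.Theory Num.Theory.

(** The growth of [alpha] is already visible on the abelianization: [GR alpha]
equals the growth rate on Gamma_1/Gamma_2, and every other term of the two
maxima is at most [GR alpha].

Lower bound: GR(alpha on Gamma_k/Gamma_(k+1)) <= GR(alpha)^k
([GR_lcs_image_le]). The factor is generated by k-fold commutators, which are
linear in each entry modulo Gamma_(k+1). Hence the length of alpha^m [x_1, ...,
x_k] in the factor is at most a constant times the product of the lengths of
the alpha^m x_i, each of which is O(lambda^m) for every lambda > GR(alpha).
[factor_growth] carries this out one entry at a time.

Upper bound: GR(alpha) is at most the growth rate induced on any quotient of
Gamma by a subgroup of Gamma_2 ([GR_le_of_ker_lcs2]). Suppose lengths of
alpha^m x modulo Gamma_j are O(lambda^m) for every lambda > rho. Then so are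
those modulo Gamma_(j+1). First, for z in Gamma_j the image of alpha^m z modulo
Gamma_(j+1) is a fixed number of commutators whose entries only matter modulo
Gamma_2, so they can be replaced by short words; since the length of a
commutator is linear in the lengths of its entries, alpha^m z has length
O(lambda^m) ([growth_lcs_mod]). Second, fix a large M and write alpha^M s = u z
for each generator s, with z in Gamma_j, the words u being of total length less
than lambda^M. Applying alpha^m shows that the sum L(m) of the lengths of the
alpha^m s modulo Gamma_(j+1) satisfies L(m + M) <= A L(m) + O(lambda^m) with A
< lambda^M, whence L(m) = O(lambda^m) ([growth_mod_succ]). No estimate on the
distortion of Gamma_j in Gamma enters. Nilpotency ends the induction at the
trivial subgroup Gamma_(t+1).

In the first formula the upper bound is applied to Gamma/Gamma_2; in the second
one to Gamma/Gamma_t when t > 1, and to Gamma_1 = Gamma itself when t = 1. *)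

(** * Word lengths and homomorphisms *)

Section WordLength.
Local Open Scope classical_set_scope.
Local Open Scope group_scope.

(** A [{multiplicative G -> H}] need not carry the instance of a
unit-preserving morphism required by the generic lemmas, hence the versions for
groups below. *)
Lemma morph1 (G H : groupType) (phi : {multiplicative G -> H}) : phi 1 = 1.
Proof. by apply: (mulgI (phi 1)); rewrite -gmulfM !mulg1. Qed.

Lemma morphV (G H : groupType) (phi : {multiplicative G -> H}) :
  {morph phi : x / x^-1}.
Proof.
by move=> x; apply: (mulgI (phi x)); rewrite -gmulfM !mulgV morph1.
Qed.

Lemma morphF (G H : groupType) (phi : {multiplicative G -> H}) :
  {morph phi : x y / x / y}.
Proof. by move=> x y; rewrite gmulfM morphV. Qed.

Lemma morphJ (G H : groupType) (phi : {multiplicative G -> H}) :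
  {morph phi : x y / x ^ y}.
Proof. by move=> x y; rewrite /conjg !gmulfM morphV. Qed.

Lemma morphR (G H : groupType) (phi : {multiplicative G -> H}) :
  {morph phi : x y / [~ x, y]}.
Proof. by move=> x y; rewrite !commgEl gmulfM morphJ morphV. Qed.

Lemma gen_min (G : groupType) (A H : set G) :
  is_subgroup H -> A `<=` H -> gen A `<=` H.
Proof. by move=> sH AH x; apply. Qed.

Lemma generates_sub (G : groupType) (T : seq G) (H : set G) :
  generates T -> is_subgroup H -> (forall x, x \in T -> H x) -> forall x, H x.
Proof.
by move=> gT sH TH x; apply: (gen_min sH TH); rewrite (gT : gen _ = _).
Qed.

Lemma spelledM (G : groupType) (T : seq G) x y m n :
  spelled T x m -> spelled T y n -> spelled T (x * y) (m + n).
Proof.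
move=> [u [Tu <- <-]] [v [Tv <- <-]]; exists (u ++ v).
by rewrite all_cat Tu Tv big_cat size_cat.
Qed.

Lemma spelledV (G : groupType) (T : seq G) x n :
  spelled T x n -> spelled T x^-1 n.
Proof.
move=> [w [Tw <- <-]]; elim: w Tw => [|a w IHw] /=.
  by exists [::]; rewrite big_nil invg1.
move=> /andP[Ta /IHw Tw]; rewrite big_cons invgM -addn1.
apply: spelledM => //; exists [:: a^-1].
by rewrite /= big_seq1 invgK orbC Ta.
Qed.

Lemma spelled_gen (G : groupType) (T : seq G) s : s \in T -> spelled T s 1.
Proof. by move=> Ts; exists [:: s]; rewrite /= big_seq1 Ts. Qed.

Lemma spelled1 (G : groupType) (T : seq G) : spelled T 1 0.
Proof. by exists [::]; rewrite big_nil. Qed.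

Lemma word_lengthP (G : groupType) (T : seq G) g : generates T ->
  spelled T g (word_length T g) /\
  forall m, spelled T g m -> (word_length T g <= m)%N.
Proof.
move=> gT; rewrite /word_length.
set A : set nat := [set n | _]; suff : exists n, A n by apply: xgetPex.
have exTg : exists n, `[< spelled T g n >].
  apply: (generates_sub (H := [set x | exists n, `[< spelled T x n >]]) gT).
    split=> [|x y /= [m /asboolP Tm] [n /asboolP Tn]].
      by exists 0%N; apply/asboolP/spelled1.
    by exists (m + n)%N; apply/asboolP/spelledM => //; apply: spelledV.
  by move=> x Tx; exists 1%N; apply/asboolP/spelled_gen.
case: (ex_minnP exTg) => m /asboolP Tm m_min.
by exists m; split=> // p Tp; apply: m_min; apply/asboolP.
Qed.

Lemma word_length1 (G : groupType) (T : seq G) :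
  generates T -> word_length T 1 = 0%N.
Proof.
by move=> gT; apply/eqP; rewrite -leqn0; apply: (word_lengthP 1 gT).2;
  apply: spelled1.
Qed.

Lemma word_lengthM (G : groupType) (T : seq G) x y : generates T ->
  (word_length T (x * y) <= word_length T x + word_length T y)%N.
Proof.
move=> gT; apply: (word_lengthP _ gT).2.
by apply: spelledM; apply: (word_lengthP _ gT).1.
Qed.

Lemma word_lengthV (G : groupType) (T : seq G) x : generates T ->
  word_length T x^-1 = word_length T x.
Proof.
move=> gT; have le y : (word_length T y^-1 <= word_length T y)%N.
  by apply: (word_lengthP _ gT).2; apply/spelledV/(word_lengthP _ gT).1.
by apply/eqP; rewrite eqn_leq le -{1}[x]invgK le.
Qed.

Lemma word_length_ind (G : groupType) (T : seq G) (P : G -> nat -> Prop) :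
  generates T -> P 1 0%N ->
  (forall s x n, s \in T -> P x n -> P (s * x) n.+1) ->
  (forall s x n, s \in T -> P x n -> P (s^-1 * x) n.+1) ->
  forall g, P g (word_length T g).
Proof.
move=> gT P1 PM PV g; have [[w [Tw <- <-]] _] := word_lengthP g gT.
elim: w Tw => [|a w IHw] /=; first by rewrite big_nil.
move=> /andP[/orP[Ta|Ta] /IHw Pw]; rewrite big_cons; first exact: PM.
by rewrite -[a]invgK; apply: PV.
Qed.

Lemma leq_sum_mem (I : eqType) (s : seq I) (F : I -> nat) i :
  i \in s -> (F i <= \sum_(j <- s) F j)%N.
Proof. by move=> si; rewrite (big_rem i) //= leq_addr. Qed.

(** Being of finite word length makes a subadditive function at most linear:
the slope is controlled by its values on the generators. *)
Lemma subadditive_le_word_length (G : groupType) (T : seq G) (f : G -> nat) :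
  generates T -> f 1 = 0%N -> (forall x y, (f (x * y)%g <= f x + f y)%N) ->
  (forall x, f x^-1%g = f x) ->
  forall g, (f g <= (\sum_(s <- T) f s) * word_length T g)%N.
Proof.
move=> gT f1 fM fV.
apply: (word_length_ind
  (P := fun g n => (f g <= (\sum_(s <- T) f s) * n)%N)) => //.
- by rewrite f1.
- move=> s x n Ts le; apply: leq_trans (fM _ _) _.
  by rewrite mulnS leq_add //; apply: leq_sum_mem.
- move=> s x n Ts le; apply: leq_trans (fM _ _) _.
  by rewrite mulnS leq_add // fV; apply: leq_sum_mem.
Qed.

Lemma word_length_morph (G H : groupType) (phi : {multiplicative G -> H})
    (T : seq G) (S : seq H) : generates T -> generates S ->
  exists c, forall g, (word_length S (phi g) <= c * word_length T g)%N.
Proof.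
move=> gT gS; exists (\sum_(s <- T) word_length S (phi s))%N.
apply: (subadditive_le_word_length (f := fun g => word_length S (phi g))) => //.
- by rewrite morph1 word_length1.
- by move=> x y; rewrite gmulfM word_lengthM.
- by move=> x; rewrite morphV word_lengthV.
Qed.

(** Lifting a shortest word letter by letter. Together with the Lipschitz bound
[word_length_morph], this makes the word length of a quotient comparable to the
least length of a lift, for any choice of the two generating sets. *)
Lemma word_length_lift (G H : groupType) (phi : {multiplicative G -> H})
    (T : seq G) (S : seq H) : generates T -> generates S ->
  (forall h, exists g, phi g = h) ->
  exists c, forall h, exists2 g, phi g = h &
    (word_length T g <= c * word_length S h)%N.
Proof.
move=> gT gS /choice[sigma sigmaK].
exists (\sum_(s <- S) word_length T (sigma s))%N.
set c := (\sum_(s <- S) _)%N.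
apply: (word_length_ind (P := fun h n => exists2 g, phi g = h &
    (word_length T g <= c * n)%N)) => //.
- by exists 1; rewrite ?morph1 ?word_length1.
- move=> s x n Ss [g <- le]; exists (sigma s * g).
    by rewrite gmulfM sigmaK.
  apply: leq_trans (word_lengthM _ _ gT) _; rewrite mulnS leq_add //.
  exact: (leq_sum_mem (fun s => word_length T (sigma s))).
- move=> s x n Ss [g <- le]; exists ((sigma s)^-1 * g).
    by rewrite gmulfM morphV sigmaK.
  apply: leq_trans (word_lengthM _ _ gT) _; rewrite mulnS leq_add //.
  rewrite word_lengthV //.
  exact: (leq_sum_mem (fun s => word_length T (sigma s))).
Qed.

Lemma generates_map (G H : groupType) (phi : {multiplicative G -> H})
    (T : seq G) : generates T -> (forall h, exists g, phi g = h) ->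
  generates (map phi T).
Proof.
move=> gT phi_surj; apply/seteqP; split=> // h _.
have [g <-] := phi_surj h; have [g1 gD] := gen_subgroup [set` map phi T].
apply: (generates_sub (H := phi @^-1` gen [set` map phi T]) gT).
  by split=> [|x y] /=; rewrite ?morph1 // morphF; apply: gD.
by move=> x Tx; apply: gen_sub; apply: map_f.
Qed.

End WordLength.

(** * Exponential bounds and growth rates *)

Section Growth.
Local Open Scope classical_set_scope.
Local Open Scope ring_scope.

(** Growth rates are handled through this predicate: GR(beta) <= rho means, for
rho >= 0, that for every lambda > rho and every g the lengths of the beta^m g
are [exp_bounded lambda] (lemmas [GR_le] and [exp_bounded_gt_GR]). *)
Definition exp_bounded (R : realType) (lambda : R) (a : nat -> nat) : Prop :=
  exists C : R, forall m, (a m)%:R <= C * lambda ^+ m.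

Lemma exp_bounded_le (R : realType) (lambda : R) (a b : nat -> nat) :
  (forall m, (a m <= b m)%N) -> exp_bounded lambda b -> exp_bounded lambda a.
Proof.
move=> ab [C bC]; exists C => m; apply: le_trans (bC m).
by rewrite ler_nat.
Qed.

Lemma exp_bounded0 (R : realType) (lambda : R) : exp_bounded lambda (fun=> 0%N).
Proof. by exists 0 => m; rewrite mul0r. Qed.

Lemma exp_boundedD (R : realType) (lambda : R) (a b : nat -> nat) :
  exp_bounded lambda a -> exp_bounded lambda b ->
  exp_bounded lambda (fun m => a m + b m)%N.
Proof.
move=> [C aC] [D bD]; exists (C + D) => m.
by rewrite natrD mulrDl lerD.
Qed.

Lemma exp_boundedM (R : realType) (lambda mu : R) (a b : nat -> nat) :
  exp_bounded lambda a -> exp_bounded mu b ->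
  exp_bounded (lambda * mu) (fun m => a m * b m)%N.
Proof.
move=> [C aC] [D bD]; exists (C * D) => m.
by rewrite natrM exprMn mulrACA ler_pM.
Qed.

Lemma exp_bounded_scale (R : realType) (lambda : R) c (a : nat -> nat) :
  exp_bounded lambda a -> exp_bounded lambda (fun m => c * a m)%N.
Proof.
move=> aL; rewrite -[lambda]mul1r; apply: exp_boundedM => //.
by exists c%:R => m; rewrite expr1n mulr1.
Qed.

Lemma exp_bounded_sum (R : realType) (lambda : R) (I : eqType) (s : seq I)
    (a : I -> nat -> nat) :
  (forall i, i \in s -> exp_bounded lambda (a i)) ->
  exp_bounded lambda (fun m => \sum_(i <- s) a i m)%N.
Proof.
elim: s => [|i s IHs] sL.
  by apply: exp_bounded_le (exp_bounded0 _) => m; rewrite big_nil.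
apply: (exp_bounded_le (b := fun m => (a i m + \sum_(j <- s) a j m)%N)).
  by move=> m; rewrite big_cons.
apply: exp_boundedD; first by apply: sL; rewrite mem_head.
by apply: IHs => j sj; apply: sL; rewrite inE sj orbT.
Qed.

Lemma exp_bounded_near (R : realType) (lambda : R) M (a : nat -> nat) :
  0 < lambda -> (forall m, (M <= m)%N -> (a m)%:R <= lambda ^+ m) ->
  exp_bounded lambda a.
Proof.
move=> l0 aM; exists (1 + \sum_(i < M) (a i)%:R / lambda ^+ i) => m.
have S0 (P : pred 'I_M) : 0 <= \sum_(i < M | P i) (a i)%:R / lambda ^+ i.
  by apply: sumr_ge0 => i _; rewrite divr_ge0 // exprn_ge0 // ltW.
have lm : 0 < lambda ^+ m by rewrite exprn_gt0.
have [mM|Mm] := ltnP m M; last first.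
  by apply: le_trans (aM _ Mm) _; apply: ler_peMl; rewrite ?lerDl // ltW.
rewrite -ler_pdivrMr // (bigD1 (Ordinal mM)) //=.
by rewrite addrCA lerDl addr_ge0.
Qed.

Lemma exp_gap (R : realType) (C lambda mu : R) : 0 < lambda -> lambda < mu ->
  exists M, forall m, (M <= m)%N -> C * lambda ^+ m < mu ^+ m.
Proof.
move=> l0 lm.
have q1 : `|lambda / mu| < 1.
  by rewrite ger0_norm ?ltr_pdivrMr ?mul1r ?divr_ge0 ?ltW //;
    apply: lt_trans lm.
have m0 : 0 < mu by apply: lt_trans lm.
have /cvgrPdist_lt := cvg_geometric C q1.
move=> /(_ 1 ltr01) [M _ MC]; exists M => m /MC /=.
rewrite sub0r normrN /geometric /= => /(le_lt_trans (ler_norm _)).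
by rewrite expr_div_n mulrA ltr_pdivrMr ?mul1r // exprn_gt0.
Qed.

(** Substituting words into words gives this kind of recursion: a block of M
steps multiplies the length by less than lambda^M, so the error terms [b], of
the same order lambda^m as the target, add up to a geometric series. *)
Lemma exp_bounded_linear_rec (R : realType) (lambda : R) (A M : nat)
    (L b : nat -> nat) : 0 < lambda -> (0 < M)%N -> A%:R < lambda ^+ M ->
  (forall m, (L (m + M) <= A * L m + b m)%N) -> exp_bounded lambda b ->
  exp_bounded lambda L.
Proof.
move=> l0 M0 AM rec [K bK].
have gap : 0 < lambda ^+ M - A%:R by rewrite subr_gt0.
have K0 : 0 <= K.
  by have := bK 0%N; rewrite expr0 mulr1; apply: le_trans; rewrite ler0n.
pose S := \sum_(i < M) (L i)%:R / lambda ^+ i.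
have S0 (P : pred 'I_M) : 0 <= \sum_(i < M | P i) (L i)%:R / lambda ^+ i.
  by apply: sumr_ge0 => i _; rewrite divr_ge0 // exprn_ge0 // ltW.
(* D solves A D + K = D lambda^M: it absorbs the error terms, while S takes
   care of the first M values. *)
pose D := K / (lambda ^+ M - A%:R).
have D0 : 0 <= D by rewrite divr_ge0 // ltW.
exists (S + D).
elim/ltn_ind => m IHm.
have lp i : 0 < lambda ^+ i by rewrite exprn_gt0.
have [mM|Mm] := ltnP m M.
  rewrite -ler_pdivrMr // /S (bigD1 (Ordinal mM)) //= -addrA lerDl.
  by rewrite addr_ge0.
rewrite -(subnK Mm) exprD; set p := (m - M)%N.
have pm : (p < m)%N.
  by rewrite /p -{2}(subnK Mm) -[X in (X < _)%N]addn0 ltn_add2l.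
apply: (@le_trans _ _ (A%:R * (L p)%:R + (b p)%:R)).
  by rewrite -natrM -natrD ler_nat.
apply: (@le_trans _ _ (A%:R * ((S + D) * lambda ^+ p) + K * lambda ^+ p)).
  by rewrite lerD // ler_wpM2l // IHm.
have KD : K = D * (lambda ^+ M - A%:R) by rewrite /D divfK // gt_eqF.
have SA : 0 <= S * (lambda ^+ M - A%:R) by rewrite mulr_ge0 // ?S0 // ltW.
have -> : A%:R * ((S + D) * lambda ^+ p) + K * lambda ^+ p =
  (A%:R * (S + D) + K) * lambda ^+ p by ring.
have -> : (S + D) * (lambda ^+ p * lambda ^+ M) =
  ((S + D) * lambda ^+ M) * lambda ^+ p by ring.
rewrite ler_wpM2r ?(ltW (lp p)) // -subr_ge0.
have -> : (S + D) * lambda ^+ M - (A%:R * (S + D) + K) =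
  S * (lambda ^+ M - A%:R) + (D * (lambda ^+ M - A%:R) - K) by ring.
by rewrite -KD subrr addr0.
Qed.

Lemma powR_root_le (R : realType) (x y : R) m : 0 <= x -> 0 <= y -> (0 < m)%N ->
  (x `^ m%:R^-1 <= y) = (x <= y ^+ m).
Proof.
move=> x0 y0 m0; have m0' : m%:R != 0 :> R by rewrite pnatr_eq0 -lt0n.
have xE : (x `^ m%:R^-1) ^+ m = x.
  by rewrite -powR_mulrn ?powR_ge0 // -powRrM mulVf // powRr1.
by rewrite -[in RHS]xE ler_pXn2r // nnegrE powR_ge0.
Qed.

Lemma GR_le (R : realType) (G : groupType) (T : seq G) (beta : G -> G)
    (rho : R) : 0 <= rho ->
  (forall lambda, rho < lambda -> forall g,
     exp_bounded lambda (fun m => word_length T (iter m beta g))) ->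
  (GR R T beta <= rho%:E)%E.
Proof.
move=> rho0 bnd; apply: ge_ereal_sup => _ [g _ <-].
apply/lee_addgt0Pr => e e0.
(* The gap between rho + e / 2 and rho + e absorbs the constant C. *)
pose lambda := rho + e / 2.
have l0 : 0 < lambda by rewrite /lambda; lra.
have [C aC] : exp_bounded lambda (fun m => word_length T (iter m beta g)).
  by apply: bnd; rewrite /lambda; lra.
have [M MC] : exists M, forall m, (M <= m)%N ->
    C * lambda ^+ m < (rho + e) ^+ m.
  by apply: exp_gap => //; rewrite /lambda; lra.
(* Exponent 0 is excluded, as the m-th root is meaningless there. *)
apply: (@le_trans _ _ (ereal_sup
  ((fun m => ((word_length T (iter m beta g))%:R `^ m%:R^-1)%:E) @`
    [set m | (M.+1 <= m)%N]))).
  apply: ereal_inf_lbound; exists [set m | (M.+1 <= m)%N] => //.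
  by exists M.+1.
apply: ge_ereal_sup => _ [m /= Mm <-]; rewrite -EFinD lee_fin.
have m0 : (0 < m)%N by apply: leq_ltn_trans Mm.
rewrite powR_root_le //; last by rewrite addr_ge0 // ltW.
by apply: le_trans (aC m) _; apply/ltW/MC/ltnW.
Qed.

Lemma GR_ge0 (R : realType) (G : groupType) (T : seq G) (beta : G -> G) :
  (0 <= GR R T beta)%E.
Proof.
apply: (@le_trans _ _ (limn_esup (fun m : nat =>
  (((word_length T (iter m beta 1%g))%:R : R) `^ (m%:R^-1))%R%:E))).
  apply: le_ereal_inf_tmp => _ [V [M _ VM] <-].
  apply: ereal_sup_ge; eexists; first by exists M => //; apply: VM => /=.
  by rewrite lee_fin powR_ge0.
by apply: ereal_sup_ubound; exists 1%g.
Qed.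

Lemma exp_bounded_gt_GR (R : realType) (G : groupType) (T : seq G)
    (beta : G -> G) (rho lambda : R) : 0 <= rho -> (GR R T beta <= rho%:E)%E ->
  rho < lambda -> forall g,
  exp_bounded lambda (fun m => word_length T (iter m beta g)).
Proof.
move=> rho0 GRrho rl g.
have l0 : 0 < lambda by apply: le_lt_trans rl.
pose u m : \bar R := (((word_length T (iter m beta g))%:R : R) `^ m%:R^-1)%:E.
have : (limn_esup u < lambda%:E)%E.
  apply: (@le_lt_trans _ _ rho%:E); last by rewrite lte_fin.
  by apply: le_trans GRrho; apply: ereal_sup_ubound; exists g.
case/ereal_inf_lt => _ [V [M _ VM] <-] supV.
apply: (@exp_bounded_near _ _ M.+1) => // m Mm.
rewrite -powR_root_le ?(ltW l0) //; last by apply: leq_ltn_trans Mm.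
rewrite -lee_fin; apply: le_trans (ltW supV).
by apply: ereal_sup_ubound; exists m => //; apply: VM; apply: ltnW.
Qed.

End Growth.

(** * Commutators modulo the lower central series *)

Section LowerCentral.
Local Open Scope classical_set_scope.
Local Open Scope quotient_scope.
Local Open Scope group_scope.

Lemma lcs_comm (G : groupType) k (x y : G) :
  lcs G k.+1 y -> lcs G k.+2 [~ x, y].
Proof. by move=> Ly; apply: gen_sub; exists x => //; exists y. Qed.

Lemma lcs_ind (G : groupType) k (H : set G) : is_subgroup H ->
  (forall x y, lcs G k.+1 y -> H [~ x, y]) -> lcs G k.+2 `<=` H.
Proof. by move=> sH HR; apply: gen_min => // _ [x _ [y Ly <-]]; apply: HR. Qed.

Lemma commMgJ (G : groupType) (x y z : G) :
  [~ x * y, z] = [~ x, z] ^ y * [~ y, z].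
Proof. by rewrite !commgEr conjgM mulgA -conjMg mulgK. Qed.

Lemma commgMJ (G : groupType) (x y z : G) :
  [~ x, y * z] = [~ x, z] * [~ x, y] ^ z.
Proof. by rewrite !commgEl conjgM -mulgA -conjMg mulVKg. Qed.

Lemma lcs_commC (G : groupType) k (x y : G) :
  lcs G k.+1 y -> lcs G k.+2 [~ y, x].
Proof.
by move=> Ly; rewrite -invgR; apply: (is_subgroupV (lcs_subgroup G _));
  apply: lcs_comm.
Qed.

Lemma lcs_subS (G : groupType) k : lcs G k.+2 `<=` lcs G k.+1.
Proof.
apply: (lcs_ind (lcs_subgroup G _)) => x y Ly.
rewrite commgEr; apply: (is_subgroupM (lcs_subgroup G _)) => //.
by apply: (lcs_is_normal G _).2; apply: (is_subgroupV (lcs_subgroup G _)).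
Qed.

Lemma lcs_subset (G : groupType) j k :
  (j <= k)%N -> lcs G k.+1 `<=` lcs G j.+1.
Proof.
move=> jk; rewrite -(subnK jk); elim: (k - j)%N => // n IHn.
by rewrite addSn; apply: subset_trans IHn; apply: lcs_subS.
Qed.

Definition lcs_pi (G : groupType) k (x : G) : lcs_quot G k :=
  \pi_(quot (lcs_normal G k)) x.

HB.instance Definition _ (G : groupType) k :=
  isMultiplicative.Build G (lcs_quot G k) (@lcs_pi G k)
    (piM (lcs_normal G k)).

Lemma lcs_pi_eq (G : groupType) k (x y : G) :
  lcs_pi k x = lcs_pi k y <-> lcs G k (x^-1 * y).
Proof. exact: (quot_eq (lcs_normal G k)). Qed.

Lemma lcs_pi_eq1 (G : groupType) k (x : G) : lcs_pi k x = 1 <-> lcs G k x.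
Proof.
rewrite -[1](morph1 (@lcs_pi G k)); split=> [/esym|Lx].
  by rewrite lcs_pi_eq invg1 mul1g.
by apply/esym/lcs_pi_eq; rewrite invg1 mul1g.
Qed.

Lemma lcs_pi_surj (G : groupType) k (q : lcs_quot G k) :
  exists x, lcs_pi k x = q.
Proof. by exists (repr q); apply: reprK. Qed.

Lemma lcs_pi_central (G : groupType) k (x : G) (q : lcs_quot G k.+2) :
  lcs G k.+1 x -> commute (lcs_pi k.+2 x) q.
Proof.
move=> Lx; have [y <-] := lcs_pi_surj q; apply/commgP; rewrite -morphR.
by apply/eqP/lcs_pi_eq1; apply: lcs_commC.
Qed.

Lemma lcs_pi_conj (G : groupType) k (x y : G) :
  lcs G k.+1 x -> lcs_pi k.+2 (x ^ y) = lcs_pi k.+2 x.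
Proof.
by move=> Lx; rewrite morphJ; apply/conjg_fixP/commgP/lcs_pi_central.
Qed.

Lemma lcs_pi_commMl (G : groupType) k (x x' y : G) : lcs G k.+1 y ->
  lcs_pi k.+3 [~ x * x', y] = lcs_pi k.+3 [~ x, y] * lcs_pi k.+3 [~ x', y].
Proof.
by move=> Ly; rewrite commMgJ gmulfM /= lcs_pi_conj //; apply: lcs_comm.
Qed.

Lemma lcs_pi_commMr (G : groupType) k (x y y' : G) :
  lcs G k.+1 y -> lcs G k.+1 y' ->
  lcs_pi k.+3 [~ x, y * y'] = lcs_pi k.+3 [~ x, y] * lcs_pi k.+3 [~ x, y'].
Proof.
move=> Ly Ly'; have Lxy := lcs_comm x Ly.
rewrite commgMJ gmulfM /= lcs_pi_conj //.
by apply: lcs_pi_central; apply: lcs_comm.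
Qed.

Lemma lcs_pi_commVl (G : groupType) k (x y : G) : lcs G k.+1 y ->
  lcs_pi k.+3 [~ x^-1, y] = (lcs_pi k.+3 [~ x, y])^-1.
Proof.
move=> Ly; apply: (mulgI (lcs_pi k.+3 [~ x, y])).
by rewrite -lcs_pi_commMl // !mulgV comm1g morph1.
Qed.

Lemma lcs_pi_commVr (G : groupType) k (x y : G) : lcs G k.+1 y ->
  lcs_pi k.+3 [~ x, y^-1] = (lcs_pi k.+3 [~ x, y])^-1.
Proof.
move=> Ly; apply: (mulgI (lcs_pi k.+3 [~ x, y])).
rewrite -lcs_pi_commMr // ?mulgV ?commg1 ?morph1 //.
exact: (is_subgroupV (lcs_subgroup G _)).
Qed.

(** A consequence of the three subgroups lemma, with a shorter reason here:
modulo Gamma_(k+3), a |-> [a, y] is a homomorphism to an abelian group, so it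
kills commutators. *)
Lemma lcs2_comm (G : groupType) k (a y : G) :
  lcs G 2 a -> lcs G k.+1 y -> lcs G k.+3 [~ a, y].
Proof.
move=> La Ly; apply/lcs_pi_eq1.
move: a La; apply: lcs_ind => [|p q _].
  split=> [|a b /= La Lb]; first by rewrite /= comm1g morph1.
  by rewrite lcs_pi_commMl // lcs_pi_commVl // La Lb divg1.
rewrite /= commgEl lcs_pi_commMl // /conjg !lcs_pi_commMl // !lcs_pi_commVl //.
set f := fun x => lcs_pi k.+3 [~ x, y]; rewrite -/(f p) -/(f q).
have cqp : commute (f q) (f p) by apply: lcs_pi_central; apply: lcs_comm.
by rewrite -cqp mulKg mulVg.
Qed.

(** The commutator pairing Gamma/Gamma_2 x Gamma_(k+1)/Gamma_(k+2) ->
Gamma_(k+2)/Gamma_(k+3) is well defined. *)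
Lemma lcs_pi_comm_eq (G : groupType) k (x x' y y' : G) : lcs G k.+1 y ->
  lcs_pi 2 x = lcs_pi 2 x' -> lcs_pi k.+2 y = lcs_pi k.+2 y' ->
  lcs_pi k.+3 [~ x, y] = lcs_pi k.+3 [~ x', y'].
Proof.
move=> Ly /lcs_pi_eq; rewrite -{2}(mulVKg x x'); set a := x^-1 * x' => La.
move=> /lcs_pi_eq; rewrite -{2}(mulVKg y y'); set b := y^-1 * y' => Lb.
have Eb z : lcs_pi k.+3 [~ z, b] = 1 by apply/lcs_pi_eq1; apply: lcs_comm.
have Ea : lcs_pi k.+3 [~ a, y] = 1 by apply/lcs_pi_eq1; apply: lcs2_comm.
rewrite lcs_pi_commMr //; last exact: lcs_subS.
by rewrite lcs_pi_commMl // Ea Eb !mulg1.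
Qed.

End LowerCentral.

(** * Growth on the factors of the lower central series *)

Section GrowthInFactors.
Local Open Scope classical_set_scope.
Local Open Scope group_scope.

Lemma iter_morphM (G : groupType) (f : {multiplicative G -> G}) m :
  {morph iter m f : x y / x * y}.
Proof. by elim: m => // m IHm x y; rewrite !iterS IHm gmulfM. Qed.

HB.instance Definition _ (G : groupType) (f : {multiplicative G -> G}) m :=
  isMultiplicative.Build G G (iter m f) (iter_morphM f m).

Lemma lcs_iter (G : groupType) (f : {multiplicative G -> G}) m k x :
  lcs G k x -> lcs G k (iter m f x).
Proof. exact: (lcs_stable (iter m f)). Qed.

(** A length on the factor Gamma_k/Gamma_(k+1), seen as a function on G. This
form allows new lengths to be built from old ones by N |-> N [s, _], as in
[factor_seminorm_comm]. *)
Definition factor_seminorm (G : groupType) k (N : G -> nat) : Prop :=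
  [/\ forall x y, lcs G k x -> lcs G k y -> (N (x * y)%g <= N x + N y)%N,
      forall x, lcs G k x -> N x^-1%g = N x &
      forall x, lcs G k.+1 x -> N x = 0%N].

Lemma factor_seminorm_eq (G : groupType) k (N : G -> nat) x y :
  factor_seminorm k.+1 N -> lcs G k.+1 x -> lcs_pi k.+2 x = lcs_pi k.+2 y ->
  N x = N y.
Proof.
move=> [NM NV N0] Lx /lcs_pi_eq Lxy.
have sL := lcs_subgroup G k.+1; have Lxy' := lcs_subS Lxy.
have Ly : lcs G k.+1 y by rewrite -(mulVKg x y); apply: is_subgroupM.
apply/eqP; rewrite eqn_leq; apply/andP; split.
  have E : x = y * (x^-1 * y)^-1 by rewrite invgM invgK mulVKg.
  rewrite {1}E; apply: leq_trans (NM _ _ Ly (is_subgroupV sL Lxy')) _.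
  by rewrite NV // (N0 _ Lxy) addn0.
rewrite -{1}(mulVKg x y); apply: leq_trans (NM _ _ Lx Lxy') _.
by rewrite (N0 _ Lxy) addn0.
Qed.

Lemma factor_seminormE (G : groupType) k (N : G -> nat) x y z :
  factor_seminorm k.+1 N -> lcs G k.+1 x -> lcs G k.+1 y ->
  lcs_pi k.+2 z = lcs_pi k.+2 x * lcs_pi k.+2 y ->
  (N z <= N x + N y)%N.
Proof.
move=> sN Lx Ly; rewrite -gmulfM => /esym E.
have Lxy : lcs G k.+1 (x * y) by apply: is_subgroupM => //; apply: lcs_subgroup.
by rewrite -(factor_seminorm_eq sN Lxy E); case: sN => NM _ _; apply: NM.
Qed.

Lemma factor_seminorm_invE (G : groupType) k (N : G -> nat) x z :
  factor_seminorm k.+1 N -> lcs G k.+1 x ->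
  lcs_pi k.+2 z = (lcs_pi k.+2 x)^-1 -> N z = N x.
Proof.
move=> sN Lx; rewrite -morphV => /esym E.
have Lx' : lcs G k.+1 x^-1 by apply: is_subgroupV => //; apply: lcs_subgroup.
by rewrite -(factor_seminorm_eq sN Lx' E); case: sN => _ NV _; apply: NV.
Qed.

Lemma factor_seminorm_comm (G : groupType) k (N : G -> nat) s :
  factor_seminorm k.+2 N -> factor_seminorm k.+1 (fun y => N [~ s, y]).
Proof.
move=> sN; split=> [x y Lx Ly | x Lx | x Lx].
- apply: (factor_seminormE sN); try exact: lcs_comm.
  exact: lcs_pi_commMr.
- apply: (factor_seminorm_invE sN); first exact: lcs_comm.
  exact: lcs_pi_commVr.
- by case: sN => _ _; apply; apply: lcs_comm.
Qed.

(** Linearity in the left entry: N [x, y] is at most the sum, over the letters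
of a word for x, of terms N [s, y] with s a generator. *)
Lemma factor_seminorm_commE (G : groupType) k (N : G -> nat) (T : seq G) x y :
  generates T -> factor_seminorm k.+2 N -> lcs G k.+1 y ->
  (N [~ x, y] <= (\sum_(s <- T) N [~ s, y]) * word_length T x)%N.
Proof.
move=> gT sN Ly.
apply: (subadditive_le_word_length (f := fun x => N [~ x, y])) => //.
- by rewrite comm1g; case: sN => _ _; apply; have [] := lcs_subgroup G k.+3.
- move=> a b; apply: (factor_seminormE sN); try exact: lcs_comm.
  exact: lcs_pi_commMl.
- move=> a; apply: (factor_seminorm_invE sN); first exact: lcs_comm.
  exact: lcs_pi_commVl.
Qed.

(** The exponent k+1 counts commutator entries. By [factor_seminorm_commE],
N [alpha^m x, alpha^m z] is at most |alpha^m x| times a sum of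
N [s, alpha^m z] over the generators s, and the functions N [s, _] are
seminorms on the previous factor. *)
Lemma factor_growth (R : realType) (G : groupType) (T : seq G)
    (alpha : {multiplicative G -> G}) (lambda : R) : generates T ->
  (forall x, exp_bounded lambda (fun m => word_length T (iter m alpha x))) ->
  forall k N y, factor_seminorm k.+1 N -> lcs G k.+1 y ->
  exp_bounded (lambda ^+ k.+1)%R (fun m => N (iter m alpha y)).
Proof.
move=> gT Tl; elim=> [|k IHk] N y sN Ly.
  have [NM NV N0] := sN.
  apply: exp_bounded_le (exp_bounded_scale (\sum_(s <- T) N s) (Tl y)) => m.
  apply: subadditive_le_word_length => // [|a b|a].
  - by apply: N0; have [] := lcs_subgroup G 2.
  - exact: NM.
  - exact: NV.
have sL := lcs_subgroup G k.+2; have [NM NV N0] := sN.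
suff : lcs G k.+2 `<=` [set z | lcs G k.+2 z /\
    exp_bounded (lambda ^+ k.+2)%R (fun m => N (iter m alpha z))].
  by move=> /(_ y Ly) [].
apply: lcs_ind => [|x z Lz].
  split=> [|a b [La aL] [Lb bL]].
    split; first by case: sL.
    apply: exp_bounded_le (exp_bounded0 _) => m.
    by rewrite morph1 N0 //; have [] := lcs_subgroup G k.+3.
  split; first by case: sL => _; apply.
  apply: exp_bounded_le (exp_boundedD aL bL) => m.
  have La' := lcs_iter alpha m La; have Lb' := lcs_iter alpha m Lb.
  rewrite morphF -(NV _ Lb'); apply: NM => //.
  exact: (is_subgroupV sL).
split; first exact: lcs_comm.
rewrite exprSr.
apply: (@exp_bounded_le _ _ _ (fun m =>
  (\sum_(s <- T) N [~ s, iter m alpha z]) * word_length T (iter m alpha x))%N).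
  move=> m; rewrite morphR.
  exact: (factor_seminorm_commE _ gT sN (lcs_iter alpha m Lz)).
apply: exp_boundedM => //; apply: exp_bounded_sum => s _.
by apply: (IHk (fun y => N [~ s, y])) => //; apply: factor_seminorm_comm.
Qed.

(** Finite generation of Gamma_(k+1)/Gamma_(k+2), phrased as an induction
principle: it is generated by the commutators [s, y] with s a generator of G
and y a generator of the previous factor. *)
Lemma lcs_finite_mod (G : groupType) (T : seq G) k : generates T ->
  exists2 X : seq G, (forall x, x \in X -> lcs G k.+1 x) &
    forall K : set G, is_subgroup K -> lcs G k.+2 `<=` K ->
      (forall x, x \in X -> K x) -> lcs G k.+1 `<=` K.
Proof.
move=> gT; elim: k => [|k [X LX XK]].
  by exists T => // K sK _ TK x _; apply: (generates_sub gT sK).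
exists [seq [~ s, y] | s <- T, y <- X].
  by move=> _ /allpairsP[[s y] [_ /= Xy ->]]; apply: lcs_comm; apply: LX.
move=> K sK LK gK; have sL := lcs_subgroup G k.+1; have [K1 KD] := sK.
have Keq z z' : lcs_pi k.+3 z = lcs_pi k.+3 z' -> K z -> K z'.
  move=> /lcs_pi_eq /LK Kzz Kz; rewrite -(mulVKg z z').
  exact: is_subgroupM.
apply: lcs_ind => // x y Ly.
apply: (generates_sub (H := [set x | K [~ x, y]]) gT).
  split=> [|a b /= Ka Kb]; first by rewrite /= comm1g.
  apply: (Keq ([~ a, y] / [~ b, y])); last exact: KD.
  by rewrite morphF lcs_pi_commMl // lcs_pi_commVl.
move=> s Ts; suff : lcs G k.+1 `<=` [set y | lcs G k.+1 y /\ K [~ s, y]].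
  by move=> /(_ y Ly) [].
apply: XK => [|z Lz|z Xz].
- split=> [|a b [La Ka] [Lb Kb]]; first by rewrite /= commg1; case: sL.
  split; first by case: sL => _; apply.
  have Lb' := is_subgroupV sL Lb.
  apply: (Keq ([~ s, a] / [~ s, b])); last exact: KD.
  by rewrite morphF lcs_pi_commMr // lcs_pi_commVr.
- by split; [apply: lcs_subS | apply: LK; apply: lcs_comm].
- by split; [apply: LX | apply: gK; apply/allpairsP; exists (s, z)].
Qed.

End GrowthInFactors.

(** * Upper bound: growth is determined modulo the derived subgroup *)

Section UpperBound.
Local Open Scope classical_set_scope.
Local Open Scope group_scope.

Definition length_mod (G : groupType) (T : seq G) k (x : G) : nat :=
  word_length (map (lcs_pi k) T) (lcs_pi k x).

Lemma generates_lcs_quot (G : groupType) (T : seq G) k :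
  generates T -> generates (map (@lcs_pi G k) T).
Proof. by move=> gT; apply: generates_map gT (@lcs_pi_surj G k). Qed.

Lemma length_mod1 (G : groupType) (T : seq G) k :
  generates T -> length_mod T k 1 = 0%N.
Proof.
by move=> gT; rewrite /length_mod morph1 word_length1 //;
  apply: generates_lcs_quot.
Qed.

Lemma length_modM (G : groupType) (T : seq G) k x y : generates T ->
  (length_mod T k (x * y)%g <= length_mod T k x + length_mod T k y)%N.
Proof.
move=> gT; rewrite /length_mod gmulfM.
exact: word_lengthM (generates_lcs_quot k gT).
Qed.

Lemma length_modV (G : groupType) (T : seq G) k x : generates T ->
  length_mod T k x^-1%g = length_mod T k x.
Proof.
move=> gT; rewrite /length_mod morphV.
exact: word_lengthV (generates_lcs_quot k gT).
Qed.

Lemma length_mod_le (G : groupType) (T : seq G) k : generates T ->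
  exists c, forall x, (length_mod T k x <= c * word_length T x)%N.
Proof.
by move=> gT; apply: (word_length_morph _ gT (generates_lcs_quot k gT)).
Qed.

Lemma length_mod_lift (G : groupType) (T : seq G) k : generates T ->
  exists c, forall x, exists2 u, lcs_pi k u = lcs_pi k x &
    (word_length T u <= c * length_mod T k x)%N.
Proof.
move=> gT; have [c cP] := word_length_lift gT (generates_lcs_quot k gT)
  (@lcs_pi_surj G k).
by exists c => x; have [u] := cP (lcs_pi k x); exists u.
Qed.

Lemma word_length_comm (G : groupType) (T : seq G) x y : generates T ->
  (word_length T [~ x, y] <= 2 * (word_length T x + word_length T y))%N.
Proof.
move=> gT; rewrite commgEl /conjg mul2n -addnn.
apply: leq_trans (word_lengthM _ _ gT) _; rewrite word_lengthV // -addnA.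
rewrite leq_add2l; apply: leq_trans (word_lengthM _ _ gT) _.
by rewrite word_lengthV // leq_add2l word_lengthM.
Qed.

(** Only the classes of x modulo Gamma_2 and of y modulo Gamma_(k+2) matter, so
both may be replaced by lifts of nearly minimal length. *)
Lemma length_mod_comm (G : groupType) (T : seq G) k : generates T ->
  exists c, forall x y, lcs G k.+1 y ->
    (length_mod T k.+3 [~ x, y] <=
       c * (length_mod T 2 x + length_mod T k.+2 y))%N.
Proof.
move=> gT; have [c cP] := length_mod_lift 2 gT.
have [d dP] := length_mod_lift k.+2 gT.
have [e eP] := length_mod_le k.+3 gT.
exists (e * (2 * (c + d)))%N => x y Ly.
have [u /esym xu ule] := cP x; have [v /esym yv vle] := dP y.
rewrite /length_mod (lcs_pi_comm_eq Ly xu yv).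
apply: leq_trans (eP _) _; rewrite -!mulnA leq_mul2l; apply/orP; right.
apply: leq_trans (word_length_comm _ _ gT) _; rewrite leq_mul2l /=.
apply: leq_trans (leq_add ule vle) _.
rewrite mulnDr; apply: leq_add; rewrite leq_mul2r.
  by rewrite leq_addr orbT.
by rewrite leq_addl orbT.
Qed.

(** Elements of Gamma_(k+1) do not grow faster modulo Gamma_(k+2) than the
whole group does modulo Gamma_2, because a commutator is a word of length
linear in those of its entries. *)
Lemma growth_lcs_mod (R : realType) (G : groupType) (T : seq G)
    (alpha : {multiplicative G -> G}) (lambda : R) : generates T ->
  (forall x, exp_bounded lambda (fun m => length_mod T 2 (iter m alpha x))) ->
  forall k z, lcs G k.+1 z ->
  exp_bounded lambda (fun m => length_mod T k.+2 (iter m alpha z)).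
Proof.
move=> gT T2; elim=> [|k IHk] z Lz; first exact: T2.
move: z Lz; apply: lcs_ind => [|x y Ly].
  split=> [|a b aL bL].
    apply: exp_bounded_le (exp_bounded0 _) => m.
    by rewrite morph1 length_mod1.
  apply: exp_bounded_le (exp_boundedD aL bL) => m.
  rewrite morphF; apply: leq_trans (length_modM _ _ _ gT) _.
  by rewrite length_modV.
have [c cP] := length_mod_comm k gT; have xyL := exp_boundedD (T2 x) (IHk y Ly).
apply: exp_bounded_le (exp_bounded_scale c xyL) => m.
by rewrite morphR; apply/cP/lcs_iter.
Qed.

(** The words u s describe alpha^M modulo Gamma_(k+2). Taking M large makes
their total length less than lambda^M although the constants in the bounds are
unknown; the corrections z s lie in Gamma_(k+2), where [growth_lcs_mod]
applies. *)
Lemma growth_mod_succ (R : realType) (G : groupType) (T : seq G)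
    (alpha : {multiplicative G -> G}) (rho : R) k : (0 <= rho)%R ->
  generates T ->
  (forall lambda, (rho < lambda)%R -> forall x,
     exp_bounded lambda (fun m => length_mod T 2 (iter m alpha x))) ->
  (forall lambda, (rho < lambda)%R -> forall x,
     exp_bounded lambda (fun m => length_mod T k.+2 (iter m alpha x))) ->
  forall lambda, (rho < lambda)%R -> forall x,
     exp_bounded lambda (fun m => length_mod T k.+3 (iter m alpha x)).
Proof.
move=> rho0 gT T2 Tk lambda rl x.
pose mu : R := ((rho + lambda) / 2)%R.
have [rmu mul mu0] : [/\ rho < mu, mu < lambda & 0 < mu]%R.
  by rewrite /mu; split; lra.
have l0 : (0 < lambda)%R by apply: lt_trans mul.
have [c cP] := length_mod_lift k.+2 gT.
pose a m := (\sum_(s <- T) c * length_mod T k.+2 (iter m alpha s))%N.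
have [C aC] : exp_bounded mu a.
  by apply: exp_bounded_sum => s _; apply: exp_bounded_scale; apply: Tk.
have [M0 MC] := exp_gap C mu0 mul.
pose M := M0.+1; have aM : ((a M)%:R < lambda ^+ M)%R.
  by apply: le_lt_trans (aC M) _; apply: MC; apply: leqnSn.
have /choice[u uP] s : exists u, lcs_pi k.+2 u = lcs_pi k.+2 (iter M alpha s) /\
    (word_length T u <= c * length_mod T k.+2 (iter M alpha s))%N.
  by have [u] := cP (iter M alpha s); exists u.
pose z s := (u s)^-1 * iter M alpha s.
have Lz s : lcs G k.+2 (z s) by apply/lcs_pi_eq; case: (uP s).
pose L m := (\sum_(s <- T) length_mod T k.+3 (iter m alpha s))%N.
pose b m := (\sum_(s <- T) length_mod T k.+3 (iter m alpha (z s)))%N.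
have Lle m y : (length_mod T k.+3 (iter m alpha y) <= L m * word_length T y)%N.
  apply: (subadditive_le_word_length
    (f := fun y => length_mod T k.+3 (iter m alpha y))) => //.
  - by rewrite morph1 length_mod1.
  - by move=> v w; rewrite gmulfM length_modM.
  - by move=> v; rewrite morphV length_modV.
suff : exp_bounded lambda L.
  move=> /(exp_bounded_scale (word_length T x)); apply: exp_bounded_le => m.
  by rewrite mulnC.
apply: (exp_bounded_linear_rec (A := a M) (M := M) (b := b)) => //.
  move=> m; rewrite /a big_distrl /= /b -big_split /=.
  apply: leq_sum => s _.
  have -> : iter (m + M) alpha s = iter m alpha (u s) * iter m alpha (z s).
    by rewrite iterD -gmulfM mulVKg.
  apply: leq_trans (length_modM _ _ _ gT) _; rewrite leq_add2r.
  apply: leq_trans (Lle _ _) _; rewrite mulnC leq_mul2r.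
  by case: (uP s) => _ ->; rewrite orbT.
by apply: exp_bounded_sum => s _; apply: growth_lcs_mod => // y; apply: T2.
Qed.

Lemma growth_mod (R : realType) (G : groupType) (T : seq G)
    (alpha : {multiplicative G -> G}) (rho : R) : (0 <= rho)%R ->
  generates T ->
  (forall lambda, (rho < lambda)%R -> forall x,
     exp_bounded lambda (fun m => length_mod T 2 (iter m alpha x))) ->
  forall k lambda, (rho < lambda)%R -> forall x,
     exp_bounded lambda (fun m => length_mod T k.+2 (iter m alpha x)).
Proof.
move=> rho0 gT T2; elim=> [|k IHk]; first exact: T2.
exact: growth_mod_succ.
Qed.

(** The hypothesis on the kernel makes every quotient map of this kind dominate
lengths modulo Gamma_2, from which [growth_mod] climbs to Gamma_(k+2) = 1. *)
Lemma GR_le_of_ker_lcs2 (R : realType) (G H : groupType) (T : seq G)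
    (S : seq H) (alpha : {multiplicative G -> G}) (beta : H -> H)
    (phi : {multiplicative G -> H}) k :
  generates T -> generates S -> lcs G k.+2 = [set 1] ->
  (forall h, exists g, phi g = h) -> (forall x, phi x = 1 -> lcs G 2 x) ->
  (forall x, phi (alpha x) = beta (phi x)) ->
  (GR R T alpha <= GR R S beta)%E.
Proof.
move=> gT gS Lk phi_surj phi_ker phi_alpha.
have [->|GRoo] := eqVneq (GR R S beta) +oo%E; first exact: leey.
have GR0 : (0 <= GR R S beta)%E := GR_ge0 _ _ _.
have GRfin : GR R S beta \is a fin_num by rewrite ge0_fin_numE // ltey.
rewrite -(fineK GRfin); set rho := fine _.
have rho0 : (0 <= rho)%R by apply: fine_ge0.
apply: GR_le => // lambda rl x.
have phi_iter m y : phi (iter m alpha y) = iter m beta (phi y).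
  by elim: m => // m IHm; rewrite !iterS phi_alpha IHm.
have T2 mu : (rho < mu)%R -> forall y,
    exp_bounded mu (fun m => length_mod T 2 (iter m alpha y)).
  move=> rmu y; have [c cP] := word_length_lift gT gS phi_surj.
  have [d dP] := length_mod_le 2 gT.
  have GRle : (GR R S beta <= rho%:E)%E by rewrite fineK.
  have := exp_bounded_gt_GR rho0 GRle rmu (phi y).
  move=> /(exp_bounded_scale (d * c)); apply: exp_bounded_le => m.
  have [u phiu ule] := cP (iter m beta (phi y)).
  have -> : length_mod T 2 (iter m alpha y) = length_mod T 2 u.
    congr word_length; apply/esym/lcs_pi_eq; apply: phi_ker.
    by rewrite gmulfM morphV phiu phi_iter mulVg.
  by apply: leq_trans (dP u) _; rewrite -mulnA leq_mul2l ule orbT.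
have [c cP] := length_mod_lift k.+2 gT.
apply: exp_bounded_le (exp_bounded_scale c (growth_mod rho0 gT T2 k rl x)) => m.
have [u /lcs_pi_eq] := cP (iter m alpha x).
by rewrite Lk => E ule; rewrite -{1}(mulVKg u (iter m alpha x)) E mulg1.
Qed.

End UpperBound.

(** * Lower bound: growth on images of the lower central subgroups *)

Section LowerBound.
Local Open Scope classical_set_scope.
Local Open Scope group_scope.

Lemma GR_finite (R : realType) (G : groupType) (T : seq G)
    (alpha : {multiplicative G -> G}) : generates T ->
  exists2 rho : R, (0 <= rho)%R & GR R T alpha = rho%:E.
Proof.
move=> gT; have [c cP] := word_length_morph alpha gT gT.
have le : (GR R T alpha <= (c%:R)%:E)%E.
  apply: GR_le => // lambda cl g; exists (word_length T g)%:R%R => m.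
  apply: (@le_trans _ _ ((word_length T g)%:R * c%:R ^+ m)%R); last first.
    by rewrite ler_wpM2l // lerXn2r // ?nnegrE ?ler0n //
      ltW // (le_lt_trans _ cl).
  rewrite -natrX -natrM ler_nat; elim: m => [|m IHm]; first by rewrite muln1.
  rewrite iterS; apply: leq_trans (cP _) _.
  by rewrite expnS mulnCA leq_mul2l IHm orbT.
have ge0 : (0 <= GR R T alpha)%E := GR_ge0 _ _ _.
have fin : GR R T alpha \is a fin_num.
  by rewrite ge0_fin_numE //; apply: le_lt_trans le _; rewrite ltry.
by exists (fine (GR R T alpha)); rewrite ?fine_ge0 ?fineK.
Qed.

Lemma GR_morph_le (R : realType) (G H : groupType) (T : seq G) (S : seq H)
    (alpha : {multiplicative G -> G}) (beta : H -> H)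
    (phi : {multiplicative G -> H}) :
  generates T -> generates S -> (forall h, exists g, phi g = h) ->
  (forall x, phi (alpha x) = beta (phi x)) ->
  (GR R S beta <= GR R T alpha)%E.
Proof.
move=> gT gS phi_surj phi_alpha.
have [rho rho0 GRE] := GR_finite R alpha gT; rewrite GRE.
have phi_iter m y : phi (iter m alpha y) = iter m beta (phi y).
  by elim: m => // m IHm; rewrite !iterS phi_alpha IHm.
apply: GR_le => // lambda rl h; have [g <-] := phi_surj h.
have [c cP] := word_length_morph phi gT gS.
have GRle : (GR R T alpha <= rho%:E)%E by rewrite GRE.
have := exp_bounded_gt_GR rho0 GRle rl g.
move=> /(exp_bounded_scale c); apply: exp_bounded_le => m.
by rewrite -phi_iter.
Qed.

(** Turns lengths on the subgroup type into functions on the ambient group, as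
[factor_seminorm] requires; the default 1 is used outside Gamma_k. *)
Definition lcs_in (G : groupType) k (y : G) : lcs_group G k := insubd 1 y.

Lemma lcs_inK (G : groupType) k (y : G) : lcs G k y -> val (lcs_in k y) = y.
Proof. by move=> Ly; apply: insubdK; apply/mem_set. Qed.

Lemma lcs_group_in (G : groupType) k (x : lcs_group G k) : lcs G k (val x).
Proof. exact/set_mem/(valP x). Qed.

Lemma lcs_in_val (G : groupType) k (x : lcs_group G k) : lcs_in k (val x) = x.
Proof. by apply: val_inj; rewrite lcs_inK //; apply: lcs_group_in. Qed.

Lemma lcs_inM (G : groupType) k (x y : G) :
  lcs G k x -> lcs G k y -> lcs_in k (x * y) = lcs_in k x * lcs_in k y.
Proof.
move=> Lx Ly; apply: val_inj; rewrite valM !lcs_inK //.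
exact: (is_subgroupM (lcs_subgroup G k)).
Qed.

Lemma lcs_inV (G : groupType) k (x : G) :
  lcs G k x -> lcs_in k x^-1 = (lcs_in k x)^-1.
Proof.
move=> Lx; apply: val_inj.
have -> : val (lcs_in k x)^-1 = (val (lcs_in k x))^-1 by apply: morphV.
rewrite !lcs_inK //.
exact: (is_subgroupV (lcs_subgroup G k)).
Qed.

Lemma finitely_generated_lcs_image (G A : groupType) k
    (phi : {multiplicative lcs_group G k.+1 -> A}) :
  finitely_generated G -> (forall a, exists x, phi x = a) ->
  (forall x, lcs G k.+2 (val x) -> phi x = 1) -> finitely_generated A.
Proof.
move=> [T gT] phi_surj phi_ker.
have [X LX XK] := lcs_finite_mod k gT.
exists [seq phi (lcs_in k.+1 x) | x <- X]; apply/seteqP; split=> // a _.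
set S := map _ X; have [g1 gD] := gen_subgroup [set` S].
have sL := lcs_subgroup G k.+1; have [L1 LD] := sL.
have LK : lcs G k.+1 `<=`
    [set y | lcs G k.+1 y /\ gen [set` S] (phi (lcs_in k.+1 y))].
  apply: XK => [|y Ly|y Xy].
  - split=> [|x y [Lx Sx] [Ly Sy]].
      split=> //; rewrite phi_ker // lcs_inK //.
      by have [] := lcs_subgroup G k.+2.
    split; first exact: LD.
    have Ly' := is_subgroupV sL Ly.
    by rewrite lcs_inM // lcs_inV // morphF; apply: gD.
  - have Ly' := lcs_subS Ly; split=> //.
    by rewrite phi_ker // lcs_inK.
  - split; first exact: LX.
    by apply: gen_sub; apply: (map_f (fun x => phi (lcs_in k.+1 x))).
have [x <-] := phi_surj a.
by have [] := LK _ (lcs_group_in x); rewrite lcs_in_val.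
Qed.

(** The homomorphism phi factors through Gamma_(k+1)/Gamma_(k+2). Both the
factors of the lower central series and the last subgroup Gamma_t itself are
of this form. *)
Lemma GR_lcs_image_le (R : realType) (G A : groupType) (T : seq G) (S : seq A)
    (alpha : {multiplicative G -> G}) (beta : A -> A) k
    (phi : {multiplicative lcs_group G k.+1 -> A}) (rho : R) :
  generates T -> generates S -> (forall a, exists x, phi x = a) ->
  (forall x, lcs G k.+2 (val x) -> phi x = 1) ->
  (forall x, phi (on_lcs_group alpha k.+1 x) = beta (phi x)) ->
  (0 <= rho)%R -> (GR R T alpha <= rho%:E)%E ->
  (GR R S beta <= (rho ^+ k.+1)%:E)%E.
Proof.
move=> gT gS phi_surj phi_ker phi_alpha rho0 GRrho.
have phi_iter m x : phi (iter m (on_lcs_group alpha k.+1) x) =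
    iter m beta (phi x).
  by elim: m => // m IHm; rewrite !iterS phi_alpha IHm.
have val_iter m x : val (iter m (on_lcs_group alpha k.+1) x) =
    iter m alpha (val x).
  by elim: m => // m IHm; rewrite !iterS -IHm.
apply: GR_le => [|mu rmu a]; first exact: exprn_ge0.
have mu0 : (0 < mu)%R by apply: le_lt_trans rmu; apply: exprn_ge0.
(* Since mu > rho^(k+1), its (k+1)-st root exceeds rho. *)
pose lambda := (mu `^ k.+1%:R^-1)%R.
have lambdaE : (lambda ^+ k.+1 = mu)%R.
  by rewrite -powR_mulrn ?powR_ge0 // -powRrM mulVf ?pnatr_eq0 // powRr1 // ltW.
have rl : (rho < lambda)%R.
  by rewrite -(@ltr_pXn2r _ k.+1) ?nnegrE ?powR_ge0 // lambdaE.
pose N y := word_length S (phi (lcs_in k.+1 y)).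
have sN : factor_seminorm k.+1 N.
  split=> [x y Lx Ly|x Lx|x Lx]; rewrite /N.
  - by rewrite lcs_inM // gmulfM word_lengthM.
  - by rewrite lcs_inV // morphV word_lengthV.
  - by rewrite phi_ker ?word_length1 // lcs_inK //; apply: lcs_subS.
have [x <-] := phi_surj a.
have := factor_growth gT (exp_bounded_gt_GR rho0 GRrho rl) sN (lcs_group_in x).
rewrite lambdaE; apply: exp_bounded_le => m.
by rewrite /N -val_iter lcs_in_val phi_iter.
Qed.

Lemma GR_root_le (R : realType) (G : groupType) (S : seq G) (beta : G -> G)
    (rho : R) k : (0 <= rho)%R -> (0 < k)%N ->
  (GR R S beta <= (rho ^+ k)%:E)%E ->
  (GR R S beta `^ (k%:R^-1)%R <= rho%:E)%E.
Proof.
move=> rho0 k0 le; have ge0 : (0 <= GR R S beta)%E := GR_ge0 _ _ _.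
have fin : GR R S beta \is a fin_num.
  by rewrite ge0_fin_numE //; apply: le_lt_trans le _; rewrite ltry.
move: le; rewrite -(fineK fin) poweR_EFin !lee_fin => le.
by rewrite powR_root_le // fine_ge0.
Qed.

End LowerBound.

(** * Quotients by terms of the lower central series *)

Section Quotients.
Local Open Scope classical_set_scope.
Local Open Scope quotient_scope.
Local Open Scope group_scope.

Definition factor_pi (G : groupType) k (x : lcs_group G k) : lcs_factor G k :=
  \pi_(quot (relative (lcs_sub G k) (lcs_normal G k.+1))) x.

HB.instance Definition _ (G : groupType) k :=
  isMultiplicative.Build (lcs_group G k) (lcs_factor G k) (@factor_pi G k)
    (piM (relative (lcs_sub G k) (lcs_normal G k.+1))).

Lemma factor_pi_surj (G : groupType) k (q : lcs_factor G k) :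
  exists x, factor_pi x = q.
Proof. by exists (repr q); apply: reprK. Qed.

Lemma factor_pi_eq1 (G : groupType) k (x : lcs_group G k) :
  factor_pi x = 1 <-> lcs G k.+1 (val x).
Proof.
rewrite -[1](morph1 (@factor_pi G k)).
have E := quot_eq (relative (lcs_sub G k) (lcs_normal G k.+1)) 1 x.
rewrite invg1 mul1g in E.
by split=> [/esym/E|Lx]; [|apply/esym/E].
Qed.

Definition to_lcs1 (G : groupType) (x : G) : lcs_group G 1 := lcs_in 1 x.

Lemma to_lcs1M (G : groupType) : {morph @to_lcs1 G : x y / x * y}.
Proof. by move=> x y; apply: lcs_inM. Qed.

HB.instance Definition _ (G : groupType) :=
  isMultiplicative.Build G (lcs_group G 1) (@to_lcs1 G) (@to_lcs1M G).

Lemma val_to_lcs1 (G : groupType) (x : G) : val (to_lcs1 x) = x.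
Proof. exact: lcs_inK. Qed.

Lemma to_lcs1_val (G : groupType) (x : lcs_group G 1) : to_lcs1 (val x) = x.
Proof. exact: lcs_in_val. Qed.

Lemma to_lcs1_on (G : groupType) (f : {multiplicative G -> G}) x :
  to_lcs1 (f x) = on_lcs_group f 1 (to_lcs1 x).
Proof. by apply: val_inj; rewrite /= val_to_lcs1 -[in LHS](val_to_lcs1 x). Qed.

Lemma lcs_pi_lcs (G : groupType) j k (x : G) :
  lcs G k.+1 x -> lcs (lcs_quot G j) k.+1 (lcs_pi j x).
Proof.
elim: k x => [|k IHk] x Lx //.
have [L1 LD] := lcs_subgroup (lcs_quot G j) k.+2.
move: x Lx; apply: lcs_ind => [|x y Ly].
  by split=> [|x y] /=; rewrite ?morph1 ?morphF //; apply: LD.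
by rewrite /= morphR; apply: lcs_comm; apply: IHk.
Qed.

Lemma lcs_quot_lift (G : groupType) j k (q : lcs_quot G j) :
  lcs (lcs_quot G j) k.+1 q -> exists2 x, lcs G k.+1 x & lcs_pi j x = q.
Proof.
elim: k q => [|k IHk] q Lq; first by have [x] := lcs_pi_surj q; exists x.
have [L1 LD] := lcs_subgroup G k.+2.
move: q Lq; apply: lcs_ind => [|p q /IHk[y Ly <-]].
  split=> [|_ _ [x Lx <-] [y Ly <-]]; first by exists 1; rewrite ?morph1.
  by exists (x / y); [apply: LD | rewrite morphF].
have [x <-] := lcs_pi_surj p; exists [~ x, y]; first exact: lcs_comm.
by rewrite morphR.
Qed.

(** The class cannot be smaller than t: if Gamma_(c+1) were contained in
Gamma_(t+1) for some c < t, taking commutators with Gamma would give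
Gamma_(c+2) inside Gamma_(t+2) = 1. *)
Lemma nilpotency_class_quot (G : groupType) t :
  nilpotency_class G t.+1 -> nilpotency_class (lcs_quot G t.+1) t.
Proof.
move=> [Gt Gmin]; split=> [|c ct Qc].
  apply/seteqP; split=> [q /lcs_quot_lift[x Lx <-]|_ ->].
    exact/lcs_pi_eq1.
  by have [] := lcs_subgroup (lcs_quot G t.+1) t.+1.
have sub : lcs G c.+1 `<=` lcs G t.+1.
  by move=> x /(lcs_pi_lcs t.+1); rewrite Qc => /lcs_pi_eq1.
apply: (Gmin c.+1 ct); apply/seteqP; split=> [|_ ->]; last first.
  by have [] := lcs_subgroup G c.+2.
rewrite -Gt; apply: lcs_ind => [|x y /sub]; first exact: lcs_subgroup.
exact: lcs_comm.
Qed.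

End Quotients.

(** * The growth rate formulas *)

Section Assembly.
Local Open Scope classical_set_scope.
Local Open Scope ereal_scope.

Lemma GR_factor_root_le (R : realType) (G : groupType) (T : seq G)
    (alpha : {multiplicative G -> G}) k (F : seq (lcs_factor G k.+1)) :
  generates T -> generates F ->
  GR R F (on_lcs_factor alpha k.+1) `^ (k.+1%:R^-1)%R <= GR R T alpha.
Proof.
move=> gT gF; have [rho rho0 GRE] := GR_finite R alpha gT.
rewrite GRE; apply: GR_root_le => //.
apply: (GR_lcs_image_le gT gF
  (phi := @factor_pi G k.+1) (alpha := alpha)) => //.
- exact: factor_pi_surj.
- by move=> x Lx; apply/factor_pi_eq1.
- by move=> x; apply/esym/on_lcs_factor_pi.
- by rewrite GRE.
Qed.

Lemma GR_le_abelianization (R : realType) (G : groupType) (T : seq G)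
    (alpha : {multiplicative G -> G}) k (F : seq (lcs_factor G 1)) :
  generates T -> generates F -> lcs G k.+2 = [set 1%g] ->
  GR R T alpha <= GR R F (on_lcs_factor alpha 1).
Proof.
move=> gT gF Lk.
apply: (GR_le_of_ker_lcs2 R gT gF Lk (phi := @factor_pi G 1 \o @to_lcs1 G)).
- move=> q; have [x <-] := factor_pi_surj q.
  by exists (val x); rewrite /= to_lcs1_val.
- by move=> x /= /factor_pi_eq1; rewrite val_to_lcs1.
- by move=> x; rewrite /= to_lcs1_on; apply/esym/on_lcs_factor_pi.
Qed.

Lemma GR_eq_max_factors (R : realType) (G : groupType) (t : nat) (T : seq G)
    (alpha : {multiplicative G -> G}) (F : forall k, seq (lcs_factor G k)) :
  nilpotency_class G t -> generates T ->
  (forall k, (1 <= k <= t)%N -> generates (F k)) ->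
  GR R T alpha = \big[maxe/0]_(1 <= k < t.+1)
    GR R (F k) (on_lcs_factor alpha k) `^ (k%:R^-1)%R.
Proof.
move=> [Gt _] gT gF; apply/eqP; rewrite eq_le; apply/andP; split; last first.
  rewrite big_nat; apply: bigmax_le => [|k]; first exact: GR_ge0.
  by case: k => // k /gF gFk; apply: GR_factor_root_le.
case: t Gt gF => [|t] Gt gF.
  rewrite big_geq //; apply: GR_le => // lambda _ g; exists 0%R => m.
  have -> : iter m alpha g = 1%g.
    have : lcs G 1 (iter m alpha g) by [].
    by rewrite Gt.
  by rewrite word_length1 // mul0r.
have gF1 : generates (F 1%N) by apply: gF.
apply: le_trans (GR_le_abelianization R alpha gT gF1 Gt) _.
rewrite big_ltn // le_max; apply/orP; left.
by rewrite invr1 poweRe1 // GR_ge0.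
Qed.

(** In class 1 the quotient is trivial and the maximum is reached on Gamma_1,
the whole group; in class at least 2 it is reached on the quotient, whose
kernel lies in Gamma_2. *)
Lemma GR_eq_max_quot_last (R : realType) (G : groupType) (t : nat) (T : seq G)
    (alpha : {multiplicative G -> G}) (Q : seq (lcs_quot G t.+1))
    (S : seq (lcs_group G t.+1)) :
  lcs G t.+2 = [set 1%g] -> generates T -> generates Q -> generates S ->
  GR R T alpha = maxe (GR R Q (on_lcs_quot alpha t.+1))
    (GR R S (on_lcs_group alpha t.+1) `^ (t.+1%:R^-1)%R).
Proof.
move=> Gt gT gQ gS; apply/eqP; rewrite eq_le ge_max; apply/and3P; split.
- rewrite le_max; case: t => [|t] in Q S Gt gQ gS *; apply/orP; [right|left].
    rewrite invr1 poweRe1 ?GR_ge0 //.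
    apply: (GR_le_of_ker_lcs2 R gT gS Gt (phi := @to_lcs1 G)).
    + by move=> x; exists (val x); apply: to_lcs1_val.
    + by move=> x /(congr1 val); rewrite val_to_lcs1 val1 => ->;
        have [] := lcs_subgroup G 2.
    + exact: to_lcs1_on.
  apply: (GR_le_of_ker_lcs2 R gT gQ Gt (phi := @lcs_pi G t.+2)).
  + exact: lcs_pi_surj.
  + by move=> x /lcs_pi_eq1; apply: lcs_subset.
  + by move=> x; apply/esym/on_lcs_quot_pi.
- apply: (GR_morph_le R gT gQ (phi := @lcs_pi G t.+1)).
    exact: lcs_pi_surj.
  by move=> x; apply/esym/on_lcs_quot_pi.
- have [rho rho0 GRE] := GR_finite R alpha gT.
  rewrite GRE; apply: GR_root_le => //.
  apply: (GR_lcs_image_le gT gS (alpha := alpha)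
    (phi := idfun :
      {multiplicative lcs_group G t.+1 -> lcs_group G t.+1})) => //.
  + by move=> x; exists x.
  + by move=> x; rewrite Gt => x1; apply: val_inj; rewrite val1.
  + by rewrite GRE.
Qed.

End Assembly.

Local Open Scope ereal_scope.

Theorem theorem4p2 (R : realType) (Gamma : groupType) (t : nat)
    (alpha : {multiplicative Gamma -> Gamma}) :
  finitely_generated Gamma -> nilpotency_class Gamma t ->
  ((forall k, (1 <= k <= t)%N -> finitely_generated (lcs_factor Gamma k)) /\
   forall (T : seq Gamma) (F : forall k, seq (lcs_factor Gamma k)),
     generates T -> (forall k, (1 <= k <= t)%N -> generates (F k)) ->
     (* growth rates are nonnegative; 0 is the maximum over the empty range *)
     GR R T alpha =
       \big[maxe/0]_(1 <= k < t.+1)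
         GR R (F k) (on_lcs_factor alpha k) `^ (k%:R^-1)%R) /\
  ((1 <= t)%N ->
   [/\ finitely_generated (lcs_quot Gamma t),
       nilpotency_class (lcs_quot Gamma t) t.-1,
       finitely_generated (lcs_group Gamma t),
       forall x y : Gamma, lcs Gamma t x -> commute x y &
       forall (T : seq Gamma) (Q : seq (lcs_quot Gamma t))
              (S : seq (lcs_group Gamma t)),
         generates T -> generates Q -> generates S ->
         GR R T alpha =
           maxe (GR R Q (on_lcs_quot alpha t))
                (GR R S (on_lcs_group alpha t) `^ (t%:R^-1)%R)]).
Proof.
move=> fgG ncG; split; first split.
- case=> // k _; apply: (finitely_generated_lcs_image fgG
    (phi := @factor_pi Gamma k.+1)); first exact: factor_pi_surj.
  by move=> x Lx; apply/factor_pi_eq1.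
- by move=> T F gT gF; apply: GR_eq_max_factors.
case: t ncG => // t ncG _; have [Gt _] := ncG; split.
- have [T gT] := fgG; exists (map (@lcs_pi Gamma t.+1) T).
  exact: generates_lcs_quot.
- exact: nilpotency_class_quot.
- apply: (finitely_generated_lcs_image fgG
    (phi := idfun :
      {multiplicative lcs_group Gamma t.+1 -> lcs_group Gamma t.+1})).
    by move=> x; exists x.
  by move=> x; rewrite Gt => x1; apply: val_inj; rewrite val1.
- move=> x y /(lcs_commC y); rewrite Gt => /= xy1.
  by apply/commgP/eqP.
- by move=> T Q S; apply: GR_eq_max_quot_last.
Qed.
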